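(* Given a dominant weight $\lambda$ of size $n$, and $\sigma \in F(\lambda+\rho, n)$, we have \begin{equation*} \sum_{(w,T) \in f^{-1}(\sigma)} (-1)^{\ell(wT)}t^{\frac{1}{2}(\ell(w)+\ell(wT)-|T|)}(t-1)^{|T|}=(-1)^{n-a_{0}+\ell(C)}t^{n-a_{0}+\mathrm{inv}(\sigma)}(1-t)^{\mathrm{des}(\sigma)}, \end{equation*} where $C$ is the first column of $\sigma$, and $a_{0}$ is the unique entry of $[n]$ missing from $C$.
   Context: Type $A_{n-1}$ setting: the Weyl group is $W=S_n$ (one-line notation, length function $\ell$, Bruhat order $<$), $(i,j)$ denotes both the root $\epsilon_i-\epsilon_j$ and the transposition of values $i,j$. A dominant weight is identified with a partition $\lambda=(\lambda_1\ge\dots\ge\lambda_{n-1}\ge\lambda_n=0)$; $\rho=(n-1,n-2,\dots,1)$, and $\mu'$ denotes the conjugate partition of $\mu$. For $k<n$ let $\overline{\Gamma}(k)$ be the sequence of transpositions $((1,k+1),(1,k+2),\dots,(1,n),(2,k+1),\dots,(2,n),\dots,(k,k+1),\dots,(k,n))$, and $\overline{\Gamma}'(k)$ the sequence obtained by removing the transposition $(i,k+1)$ at the start of each row $i$. For the partition $\mu=\lambda+\rho$, the chain is $\overline{\Gamma}=\overline{\Gamma}_1\cdots\overline{\Gamma}_{\mu_1}$ with $\overline{\Gamma}_j=\overline{\Gamma}'(\mu'_j)$ if $j=\min\{i:\mu'_i=\mu'_j\}$ and $\overline{\Gamma}_j=\overline{\Gamma}(\mu'_j)$ otherwise. With $m$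 the number of transpositions $r_1,\dots,r_m$ in $\overline{\Gamma}$, $\mathcal{A}(\overline{\Gamma})$ is the set of pairs $(w,T)$, $w\in S_n$, $T=\{k_1<\dots<k_s\}\subseteq[m]$, with $w<wr_{k_1}<wr_{k_1}r_{k_2}<\dots<wr_{k_1}\cdots r_{k_s}$ in Bruhat order; write $wT=wr_{k_1}\cdots r_{k_s}$ and $|T|=s$. The splitting of $\overline{\Gamma}$ into $\overline{\Gamma}_1\cdots\overline{\Gamma}_{\mu_1}$ induces $T=T_1\cdots T_{\mu_1}$; set $\pi_j=wT_1\cdots T_j$. The filling map $f$ sends $(w,T)\in\mathcal{A}(\overline{\Gamma})$ to the filling of shape $\mu$ with $\sigma(i,j)=\pi_j(i)$ (column $j$ consists of the first $\mu'_j$ entries of $\pi_j$). Two cells attack if they are in the same column, or in consecutive columns $(i,j),(k,j+1)$ with $i>k$. $F(\mu,n)$ is the set of fillings $\sigma:\mu\to[n]$ with $\sigma(u)\ne\sigma(v)$ whenever $u,v$ attack, and weakly increasing along rows ($\sigma(u)\le\sigma(r(u))$, $r(u)$ the cell directly right of $u$). $\mathrm{inv}(\sigma)$ is the number of pairs of cells $(u,v)$ with $v=(i,k+1)$, $u=(j,k)$, $i<j$, and $\sigma(u)<\sigma(v)<\sigma(w)$ where $w$ is the cell directly to the right of $u$ if it exists (otherwise only $\sigma(u)<\sigma(v)$ is required); $\mathrm{des}(\sigma)$ is the number of cells $u$ with $\sigma(u)<\sigma(r(u))$. For a column $C$ viewed as a sequence, $\ell(C)$ is its number of inversions (pairs $i<j$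 with $C(i)>C(j)$). *)

(* Defs.v *)
(* Conventions:
   - values [n] = {1..n} are encoded 0-based as 'I_n (value v <-> v+1);
   - rows and columns of the shape mu = lam + rho are 0-based;
   - W = S_n is {perm 'I_n}; one-line notation w(i) = w i;
   - the Weyl group product w r (composition w o r, acting on positions)
     is the MathComp product (r * w)%g, since (r * w) x = w (r x). *)
From HB Require Import structures.
From mathcomp Require Import all_boot all_order all_algebra all_fingroup.
Unset Printing Implicit Defensive.

Section Defs.
Variable n : nat.
Variable lam : seq nat.

Definition len (w : {perm 'I_n}) : nat :=
  #|[set p : 'I_n * 'I_n | (p.1 < p.2) && (w p.2 < w p.1)]|.

Definition rmul (w : {perm 'I_n}) (ab : 'I_n * 'I_n) : {perm 'I_n} :=
  (tperm ab.1 ab.2 * w)%g.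

(* Bruhat order: u <= v iff v = u t_1 ... t_k with t_i transpositions and
   lengths strictly increasing along the way (Bjorner-Brenti Def. 2.1.1). *)
Definition bruhat_step : rel {perm 'I_n} := fun x y =>
  [exists p : 'I_n * 'I_n, (p.1 != p.2) && (y == rmul x p)] && (len x < len y).
Definition bruhat_le (u v : {perm 'I_n}) : bool := connect bruhat_step u v.
Definition bruhat_lt (u v : {perm 'I_n}) : bool := (u != v) && bruhat_le u v.

(* mu = lam + rho, 0-based rows: mu_i = lam_i + (n-1-i) *)
Definition mu (i : nat) : nat := nth 0 lam i + (n.-1 - i).
Definition ncols : nat := mu 0.
Definition conj (j : nat) : nat := count (fun i => j < mu i) (iota 0 n).
Definition in_shape (i j : nat) : bool := (j < ncols) && (i < conj j).

Definition Gfull (k : nat) : seq ('I_n * 'I_n) :=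
  flatten [seq [seq (a, b) | b : 'I_n <- enum 'I_n & k <= b] | a : 'I_n <- enum 'I_n & a < k].
Definition Gprime (k : nat) : seq ('I_n * 'I_n) :=
  flatten [seq [seq (a, b) | b : 'I_n <- enum 'I_n & k < b] | a : 'I_n <- enum 'I_n & a < k].

Definition block (j : nat) : seq ('I_n * 'I_n) :=
  if find (fun i => conj i == conj j) (iota 0 ncols) == j
  then Gprime (conj j) else Gfull (conj j).
Definition chain : seq ('I_n * 'I_n) :=
  flatten [seq block j | j <- iota 0 ncols].
Definition cut (j : nat) : nat := sumn [seq size (block i) | i <- iota 0 j.+1].

(* T subset of [m] is encoded by its characteristic bit sequence (size m);
   mask T chain = (r_{k_1}, ..., r_{k_s}) with k_1 < ... < k_s. *)
Definition admissible (w : {perm 'I_n}) (T : seq bool) : bool :=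
  path bruhat_lt w (scanl rmul w (mask T chain)).
Definition wT (w : {perm 'I_n}) (T : seq bool) : {perm 'I_n} :=
  foldl rmul w (mask T chain).
Definition pi_col (w : {perm 'I_n}) (T : seq bool) (j : nat) : {perm 'I_n} :=
  foldl rmul w (mask (take (cut j) T) (take (cut j) chain)).

Definition fill_eq (sigma : 'I_n -> nat -> 'I_n) (w : {perm 'I_n})
    (T : seq bool) : bool :=
  [forall i : 'I_n, forall j : 'I_ncols,
     (i < conj j) ==> (sigma i j == pi_col w T j i)].

Definition in_F (sigma : 'I_n -> nat -> 'I_n) : Prop :=
  [/\ (forall (j : nat) (i1 i2 : 'I_n), in_shape i1 j -> in_shape i2 j ->
          i1 != i2 -> sigma i1 j != sigma i2 j),
      (forall (j : nat) (i k : 'I_n), in_shape i j -> in_shape k j.+1 ->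
          k < i -> sigma i j != sigma k j.+1) &
      (forall (j : nat) (i : 'I_n), in_shape i j -> in_shape i j.+1 ->
          sigma i j <= sigma i j.+1)].

Definition inv_fill (sigma : 'I_n -> nat -> 'I_n) : nat :=
  \sum_(k < ncols) #|[set p : 'I_n * 'I_n |
      [&& in_shape p.1 k, in_shape p.2 k.+1, p.2 < p.1,
          sigma p.1 k < sigma p.2 k.+1 &
          in_shape p.1 k.+1 ==> (sigma p.2 k.+1 < sigma p.1 k.+1)]]|.

Definition des_fill (sigma : 'I_n -> nat -> 'I_n) : nat :=
  \sum_(k < ncols) #|[set i : 'I_n |
      [&& in_shape i k, in_shape i k.+1 & sigma i k < sigma i k.+1]]|.

Definition lenC (sigma : 'I_n -> nat -> 'I_n) : nat :=
  #|[set p : 'I_n * 'I_n |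
      [&& p.1 < p.2, in_shape p.2 0 & sigma p.2 0 < sigma p.1 0]]|.

End Defs.

(* Main.v *)
Require Import Defs.
From HB Require Import structures.
From mathcomp Require Import all_boot all_order all_algebra all_fingroup.
From mathcomp Require Import zify ring.
Import GRing.Theory.

(** The first block of the chain is empty, so the first column forces [w], and
  [ell(w) = ell(C) + n - a_0]. A step [u < u (a,b)] raises the length by [1 + 2 c], where [c]
  is the number of positions strictly between [a] and [b] whose value lies strictly between
  [u(a)] and [u(b)]; hence each summand is [(-t)^ell(w)] times the product of [(1-t) t^c] over
  the steps. Along one row of a block, an entry that position [a] passes over is either used
  as an intermediate value (factor [1-t]) or skipped (factor [t]), so those choices sum to [1],
  and the row contributes [(1-t) t^N] if the entry in row [a] changes from [x] to [y], where
  [N] counts the entries below it in the old column with value in [(x,y)], and [1] otherwise.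
  Thus the sum factors over pairs of consecutive columns [C, D], and
  [ell(C) + N(C,D) = inv(C,D) + ell(D)] turns the exponent of [t] into
  [n - a_0 + inv(sigma)]. *)

(** * Length under a transposition, and Bruhat comparison *)

Lemma sum_pair_split {n : nat} (a b : 'I_n) (f : 'I_n -> 'I_n -> nat) : a != b ->
  \sum_x \sum_y f x y =
    \sum_(x | (x != a) && (x != b)) \sum_(y | (y != a) && (y != b)) f x y
    + \sum_(x | (x != a) && (x != b)) (f x a + f x b + f a x + f b x)
    + (f a a + f a b + f b a + f b b).
Proof.
move=> ab.
have ba : b != a by rewrite eq_sym.
have split1 (g : 'I_n -> nat) :
    \sum_x g x = g a + g b + \sum_(x | (x != a) && (x != b)) g x.
  by rewrite (bigD1 a) //= (bigD1 b) //= addnA.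
rewrite split1 !split1.
rewrite [in LHS](eq_bigr _ (fun x _ => split1 (f x))) !big_split /=.
lia.
Qed.

(** The bounds [q] and [d] are free and [w] is any function, so that the count serves both for one
    step, with [d = w q], and for [N(C,D)], where [w] is a column. *)
Definition between {n : nat} (w : 'I_n -> 'I_n) (a : 'I_n) (q : nat) (d : 'I_n) : nat :=
  \sum_(p : 'I_n) [&& a < p, p < q, w a < w p & w p < d].

Lemma len_sum {n : nat} (w : {perm 'I_n}) :
  len n w = \sum_(x : 'I_n) \sum_(y : 'I_n) ((x < y) && (w y < w x)).
Proof.
rewrite /len cardsE -sum1_card big_mkcond pair_big /=.
by apply: eq_bigr => -[x y] _; rewrite unfold_in /=; case: (_ && _).
Qed.

(** Reindexing by the transposition leaves the pairs that avoid [a] and [b] unchanged; the pair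
    itself adds 1, and any other position adds 2 exactly when it lies between in place and in
    value. *)
Lemma len_rmul {n : nat} (w : {perm 'I_n}) (a b : 'I_n) : a < b -> w a < w b ->
  len n (rmul n w (a, b)) = len n w + 1 + 2 * between w a b (w b).
Proof.
move=> ab wab.
have nab : a != b by rewrite neq_ltn ab.
rewrite !len_sum /rmul /=.
rewrite (reindex_inj (@perm_inj _ (tperm a b))) /=.
under eq_bigr => x _.
  rewrite (reindex_inj (@perm_inj _ (tperm a b))) /=.
  under eq_bigr => y _ do rewrite !permM !tpermK.
  over.
rewrite (sum_pair_split _ _ _ nab) [in RHS](sum_pair_split _ _ _ nab).
have -> : between w a b (w b) = \sum_(x | (x != a) && (x != b))
    [&& a < x, x < b, w a < w x & w x < w b].
  rewrite /between [LHS](bigID (fun x => (x != a) && (x != b))) /= [X in _ + X]big1 ?addn0 //.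
  by move=> x; rewrite negb_and !negbK => /orP[]/eqP ->; rewrite ltnn ?andbF.
rewrite big_distrr /=.
rewrite tpermL tpermR !ltnn /= ab wab (leq_gtF (ltnW ab)) (leq_gtF (ltnW wab)) /=.
have -> : \sum_(x | (x != a) && (x != b)) \sum_(y | (y != a) && (y != b))
    ((tperm a b x < tperm a b y) && (w y < w x)) =
  \sum_(x | (x != a) && (x != b)) \sum_(y | (y != a) && (y != b))
    ((x < y) && (w y < w x)).
  apply: eq_bigr => x /andP[xa xb]; apply: eq_bigr => y /andP[ya yb].
  by rewrite !tpermD // eq_sym.
suff -> : \sum_(x | (x != a) && (x != b))
    (((tperm a b x < b) && (w a < w x)) + ((tperm a b x < a) && (w b < w x))
     + ((b < tperm a b x) && (w x < w a)) + ((a < tperm a b x) && (w x < w b))) =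
  \sum_(x | (x != a) && (x != b))
    (((x < a) && (w a < w x)) + ((x < b) && (w b < w x))
     + ((a < x) && (w x < w a)) + ((b < x) && (w x < w b)))
  + \sum_(x | (x != a) && (x != b)) 2 * [&& a < x, x < b, w a < w x & w x < w b].
  have ar A B C : A + (B + C) + (0 + 0 + 1 + 0) = A + B + (0 + 0 + 0 + 0) + 1 + C by lia.
  exact: ar.
rewrite -big_split /=; apply: eq_bigr => x /andP[xa xb].
rewrite tpermD 1?eq_sym //.
have : w x != w a by rewrite (inj_eq perm_inj).
have : w x != w b by rewrite (inj_eq perm_inj).
move: xa xb; rewrite -!val_eqE /=; lia.
Qed.

Lemma rmulK {n : nat} (w : {perm 'I_n}) (r : 'I_n * 'I_n) : rmul n (rmul n w r) r = w.
Proof. by rewrite /rmul mulgA tperm2 mul1g. Qed.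

Lemma len_rmul_gt {n : nat} (w : {perm 'I_n}) (r : 'I_n * 'I_n) : r.1 < r.2 ->
  (len n w < len n (rmul n w r)) = (w r.1 < w r.2).
Proof.
case: r => a b /= ab; apply/idP/idP => [|wab]; last by rewrite len_rmul //; lia.
apply: contraTT; rewrite -!leqNgt leq_eqVlt => /orP[/eqP e|wab].
  by move/val_inj/perm_inj: e ab => ->; rewrite ltnn.
(* If [w b < w a], the swapped permutation ascends to [w], as the transposition undoes itself. *)
have := len_rmul (rmul n w (a, b)) a b ab; rewrite rmulK => -> //; first lia.
by rewrite /rmul !permM /= tpermL tpermR.
Qed.

Lemma bruhat_lt_len {n : nat} (u v : {perm 'I_n}) : bruhat_lt n u v -> len n u < len n v.
Proof.
rewrite /bruhat_lt /bruhat_le => /andP[uv /connectP[s]].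
case: s => [|x s] /= ; first by move=> _ e; rewrite e eqxx in uv.
move=> p -> {uv v}; elim: s u x p => [|y s IH] u x /=.
  by case/andP => /andP[].
by case/andP => /andP[_ ux] /IH; apply: ltn_trans.
Qed.

(** Going up in Bruhat order raises the length, and for one transposition the change of length
    decides which entry is larger; the closure thus becomes a test on two values. *)
Lemma bruhat_lt_rmul {n : nat} (w : {perm 'I_n}) (r : 'I_n * 'I_n) : r.1 < r.2 ->
  bruhat_lt n w (rmul n w r) = (w r.1 < w r.2).
Proof.
move=> r12; apply/idP/idP => [/bruhat_lt_len|]; rewrite -(len_rmul_gt w r) // => h.
apply/andP; split; first by apply: contraTneq h => <-; rewrite ltnn.
apply: connect1; rewrite /bruhat_step h andbT.
by apply/existsP; exists r; rewrite eqxx andbT neq_ltn r12.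
Qed.

(** * Weights of chains in Bruhat order *)

(** The indicator kills every step that does not go up, so sums may run over all subsets of the
    chain instead of the admissible ones. *)
Definition step_weight {R : comNzRingType} (t : R) {n : nat} (w : {perm 'I_n})
    (r : 'I_n * 'I_n) : R :=
  ((w r.1 < w r.2)%N%:R * (1 - t) * t ^+ between w r.1 r.2 (w r.2))%R.

Fixpoint path_weight {R : comNzRingType} (t : R) {n : nat} (w : {perm 'I_n})
    (s : seq ('I_n * 'I_n)) : R :=
  if s is r :: s' then (step_weight t w r * path_weight t (rmul n w r) s')%R else 1%R.

Lemma path_weight_cat {R : comNzRingType} (t : R) {n : nat} (w : {perm 'I_n}) s1 s2 :
  path_weight t w (s1 ++ s2) =
    (path_weight t w s1 * path_weight t (foldl (rmul n) w s1) s2)%R.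
Proof. by elim: s1 w => [|r s1 IH] w /=; rewrite ?mul1r // IH mulrA. Qed.

Lemma path_weight_bruhat {R : comNzRingType} (t : R) {n : nat} (w : {perm 'I_n}) s :
  all (fun r : 'I_n * 'I_n => r.1 < r.2) s ->
  if path (bruhat_lt n) w (scanl (rmul n) w s) then
    exists c, len n (foldl (rmul n) w s) = len n w + size s + 2 * c
      /\ path_weight t w s = ((1 - t) ^+ size s * t ^+ c)%R
  else path_weight t w s = 0%R.
Proof.
elim: s w => [|r s IH] w /=; first by exists 0; rewrite expr0 mulr1; split=> //; lia.
case/andP=> r12 /(IH (rmul n w r)) {IH}.
rewrite bruhat_lt_rmul // /step_weight; case: ltnP => [wr|_]; last by rewrite !mul0r.
case: ifP => _ [] /= => [c [lc ->]|->]; last by rewrite mulr0.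
exists (c + between w r.1 r.2 (w r.2)); split.
  by rewrite lc {1}(surjective_pairing r) len_rmul //; lia.
by rewrite exprS exprD; ring.
Qed.

(** With [k] the size of [s], the length grows by [k + 2 c], so the half-sum is [len w + c], and the
    sign [(-1)^k] turns [(t - 1)^k] into [(1 - t)^k]. *)
Lemma summand_path_weight {R : comNzRingType} (t : R) {n : nat} (w : {perm 'I_n}) s :
  all (fun r : 'I_n * 'I_n => r.1 < r.2) s ->
  let v := foldl (rmul n) w s in
  ((path (bruhat_lt n) w (scanl (rmul n) w s))%:R *
    ((-1) ^+ len n v * t ^+ ((len n w + len n v - size s)./2)%N * (t - 1) ^+ size s))%R
  = ((- t) ^+ len n w * path_weight t w s)%R.
Proof.
move=> /(path_weight_bruhat t w) /=; case: ifP => _ => [[c [-> ->]]|->]; last by rewrite mulr0 mul0r.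
have -> : (len n w + (len n w + size s + 2 * c) - size s)./2 = len n w + c by lia.
rewrite mul1r -(opprB 1%R t) (exprNn (1 - t)%R) (exprNn t) !exprD expr0 mulr1.
have := sqrr_sign R (size s); have := sqrr_sign R c; rewrite !expr2.
move: ((-1) ^+ size s)%R ((-1) ^+ c)%R ((-1) ^+ len n w)%R => e d f dd ee.
by rewrite -[RHS]mul1r -ee -[RHS]mul1r -dd; ring.
Qed.

(** * Sums over subsets of a word *)

(** The summand takes a plain sequence, so a sum over a concatenation splits without casts between
    tuple types. *)
Definition bitsum {R : nmodType} (m : nat) (F : seq bool -> R) : R :=
  (\sum_(T : m.-tuple bool) F T)%R.

Lemma eq_bitsum {R : nmodType} m (F G : seq bool -> R) :
  (forall T, size T = m -> F T = G T) -> bitsum m F = bitsum m G.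
Proof. by move=> FG; apply: eq_bigr => T _; apply: FG; rewrite size_tuple. Qed.

Lemma bitsum0 {R : nmodType} (F : seq bool -> R) : bitsum 0 F = F [::].
Proof.
rewrite /bitsum (big_pred1 (nil_tuple bool)) //= => T.
by apply/esym/eqP; apply: tuple0.
Qed.

Lemma bitsumS {R : nmodType} m (F : seq bool -> R) :
  bitsum m.+1 F = (bitsum m (F \o cons false) + bitsum m (F \o cons true))%R.
Proof.
rewrite /bitsum (reindex (fun p : bool * m.-tuple bool => cons_tuple p.1 p.2)) /=.
  rewrite -(pair_bigA _ (fun b (T : m.-tuple bool) => F (b :: T))) /=.
  by rewrite big_bool /= addrC.
exists (fun T : m.+1.-tuple bool => (thead T, behead_tuple T)) => [[b T] _|T _] /=.
  by congr (_, _); apply: val_inj.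
by rewrite [RHS]tuple_eta; apply: val_inj.
Qed.

Lemma bitsum_cat {R : nmodType} m1 m2 (F : seq bool -> R) :
  bitsum (m1 + m2) F = bitsum m1 (fun T1 => bitsum m2 (fun T2 => F (T1 ++ T2))).
Proof.
by elim: m1 F => [|m1 IH] F; rewrite ?bitsum0 //= addSn !bitsumS !IH.
Qed.

(** [Phi] acts as a continuation: it receives the permutation at the end of the word, so that sums
    over successive words nest. *)
Fixpoint subword_sum {R : comNzRingType} (t : R) {n : nat} (L : seq ('I_n * 'I_n))
    (w : {perm 'I_n}) (Phi : {perm 'I_n} -> R) : R :=
  if L is r :: L' then
    (subword_sum t L' w Phi + step_weight t w r * subword_sum t L' (rmul n w r) Phi)%R
  else Phi w.

Lemma bitsum_subword {R : comNzRingType} (t : R) {n : nat} (L : seq ('I_n * 'I_n)) w Phi :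
  bitsum (size L) (fun T =>
    (path_weight t w (mask T L) * Phi (foldl (rmul n) w (mask T L)))%R)
  = subword_sum t L w Phi.
Proof.
elim: L w => [|r L IH] w /=; first by rewrite bitsum0 /= mul1r.
rewrite bitsumS /= -!IH; congr (_ + _)%R.
rewrite /bitsum big_distrr /=; apply: eq_bigr => T _.
by rewrite mulrA.
Qed.

Lemma subword_sum_cat {R : comNzRingType} (t : R) {n : nat} (L1 L2 : seq ('I_n * 'I_n)) w Phi :
  subword_sum t (L1 ++ L2) w Phi =
    subword_sum t L1 w (fun u => subword_sum t L2 u Phi).
Proof. by elim: L1 w => [|r L IH] w //=; rewrite !IH. Qed.

(** No transposition in [L] touches position [i], so its value survives to the end, where [Phi]
    vanishes. *)
Lemma subword_sum_fix0 {R : comNzRingType} (t : R) {n : nat} (i : 'I_n)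
    (L : seq ('I_n * 'I_n)) (w : {perm 'I_n}) (Phi : {perm 'I_n} -> R) :
  all (fun r => (r.1 != i) && (r.2 != i)) L ->
  (forall u : {perm 'I_n}, u i = w i -> Phi u = 0%R) -> subword_sum t L w Phi = 0%R.
Proof.
elim: L w => [|r L IH] w /=; first by move=> _; apply.
case/andP=> /andP[r1 r2] Li H; rewrite !IH ?mulr0 ?addr0 // => u.
by rewrite /rmul permM tpermD //; apply: H.
Qed.

Fixpoint block_checks {n : nat} (B : nat -> seq ('I_n * 'I_n))
    (c : nat -> {perm 'I_n} -> bool) (js : seq nat) (w : {perm 'I_n}) (T : seq bool) : bool :=
  if js is j :: js' then
    let u := foldl (rmul n) w (mask (take (size (B j)) T) (B j)) in
    c j u && block_checks B c js' u (drop (size (B j)) T)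
  else true.

Fixpoint block_sum {R : comNzRingType} (t : R) {n : nat} (B : nat -> seq ('I_n * 'I_n))
    (c : nat -> {perm 'I_n} -> bool) (js : seq nat) (w : {perm 'I_n}) : R :=
  if js is j :: js' then
    subword_sum t (B j) w (fun u => ((c j u)%:R * block_sum t B c js' u)%R)
  else 1%R.

Lemma bitsum_blocks {R : comNzRingType} (t : R) {n : nat} B c (js : seq nat) (w : {perm 'I_n}) :
  let L := flatten [seq B j | j <- js] in
  bitsum (size L) (fun T => (path_weight t w (mask T L) * (block_checks B c js w T)%:R)%R)
  = block_sum t B c js w.
Proof.
elim: js w => [|j js IH] w /=; first by rewrite bitsum0 mul1r.
rewrite size_cat bitsum_cat -bitsum_subword; apply: eq_bitsum => T1 sT1.
rewrite -IH /bitsum mulrA big_distrr /=; apply: eq_bigr => T2 _.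
rewrite mask_cat // path_weight_cat take_size_cat // drop_size_cat // -mulnb natrM.
by ring.
Qed.


Lemma mask_take_cat {A : Type} (m : bitseq) (s1 s2 : seq A) q :
  mask (take (size s1 + q) m) (take (size s1 + q) (s1 ++ s2)) =
    mask (take (size s1) m) s1 ++ mask (take q (drop (size s1) m)) (take q s2).
Proof.
rewrite take_cat ltnNge leq_addr /= addKn.
elim: s1 m => [|x s IH] m; first by rewrite drop0 take0.
case: m => [|b m] //=.
by rewrite IH; case: b.
Qed.

(** For [j0 = 0] the prefix length [q] is [cut], so a test on prefixes of the whole chain becomes
    one that consumes [T] block by block. *)
Lemma block_checksE {n : nat} (B : nat -> seq ('I_n * 'I_n)) c m j0 (w : {perm 'I_n}) T :
  let L := flatten [seq B j | j <- iota j0 m] in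
  let q k := sumn [seq size (B j) | j <- iota j0 k.+1] in
  block_checks B c (iota j0 m) w T =
  all (fun k => c (j0 + k) (foldl (rmul n) w (mask (take (q k) T) (take (q k) L)))) (iota 0 m).
Proof.
elim: m j0 w T => [|m IH] j0 w T //=.
have := mask_take_cat T (B j0) (flatten [seq B j | j <- iota j0.+1 m]) 0.
rewrite addn0 !take0 cats0 addn0 => ->.
rewrite IH (iotaDl 1 0 m) all_map; congr (_ && _); apply: eq_all => k /=.
by rewrite addnS mask_take_cat foldl_cat.
Qed.

(** * One row of transpositions *)

Lemma enum_ord_ge_cons {n : nat} (r : 'I_n) :
  [seq i : 'I_n <- enum 'I_n | r <= i] = r :: [seq i : 'I_n <- enum 'I_n | r < i].
Proof.
apply: (inj_map val_inj); apply: (irr_sorted_eq ltn_trans ltnn) => /=.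
- rewrite sorted_map; apply: sorted_filter; first by move=> ? ? ?; apply: ltn_trans.
  by rewrite -sorted_map val_enum_ord iota_ltn_sorted.
- have ts : transitive (relpre (val : 'I_n -> nat) ltn) by move=> ? ? ?; apply: ltn_trans.
  rewrite path_map path_sortedE // filter_all /=.
  apply: sorted_filter => //.
  by rewrite -sorted_map val_enum_ord iota_ltn_sorted.
move=> x; rewrite -(map_cons val r); apply/mapP/mapP => -[y]; rewrite ?inE mem_filter mem_enum andbT.
  rewrite leq_eqVlt => /orP[/eqP/val_inj <-|ry] ->; first by exists r; rewrite ?inE ?eqxx.
  by exists y; rewrite // inE mem_filter mem_enum ry orbT.
move=> h ->; exists y => //; rewrite mem_filter mem_enum andbT.
by case/orP: h => [/eqP ->|/ltnW].
Qed.

Lemma enum_ord_ge_nil {n : nat} r : n <= r -> [seq i : 'I_n <- enum 'I_n | r <= i] = [::].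
Proof.
move=> nr; apply/eqP; rewrite -size_eq0 size_filter eqn0Ngt -has_count.
by apply/hasPn => x _; rewrite -ltnNge (leq_trans (ltn_ord x)).
Qed.

Definition row {n : nat} (q : nat) (a : 'I_n) : seq ('I_n * 'I_n) :=
  [seq (a, b) | b : 'I_n <- enum 'I_n & q <= b].

Lemma row_cons {n : nat} (q a : 'I_n) : row q a = (a, q) :: row q.+1 a.
Proof. by rewrite /row enum_ord_ge_cons. Qed.

(** Descending induction on the next position, matching the way [row_cons] peels a row. *)
Lemma row_ind (n : nat) (P : nat -> Prop) :
  (forall q, n <= q -> P q) -> (forall q : 'I_n, P q.+1 -> P q) -> forall q, P q.
Proof.
move=> P0 PS q; have [m] := ubnP (n - q); elim: m q => [|m IH] q; first by lia.
have [/P0 //|qn] := leqP n q.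
by move=> nq; apply: (PS (Ordinal qn)); apply: IH => /=; lia.
Qed.

Lemma row_nil {n : nat} q (a : 'I_n) : n <= q -> row q a = [::].
Proof. by move=> nq; rewrite /row enum_ord_ge_nil. Qed.

Lemma rmulL {n : nat} (w : {perm 'I_n}) (a b : 'I_n) : rmul n w (a, b) a = w b.
Proof. by rewrite /rmul permM tpermL. Qed.

Lemma rmulR {n : nat} (w : {perm 'I_n}) (a b : 'I_n) : rmul n w (a, b) b = w a.
Proof. by rewrite /rmul permM tpermR. Qed.

Lemma rmulD {n : nat} (w : {perm 'I_n}) (a b p : 'I_n) :
  a != p -> b != p -> rmul n w (a, b) p = w p.
Proof. by move=> ap bp; rewrite /rmul permM tpermD. Qed.

(** Along the row the value at [a] only grows, and it is taken from positions still ahead; a target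
    [d] that is behind, or ahead but smaller, is never reached. *)
Lemma row_zero {R : comNzRingType} (t : R) {n : nat} (a d : 'I_n) (Phi : {perm 'I_n} -> R) :
  (forall u : {perm 'I_n}, u a != d -> Phi u = 0%R) ->
  forall q (w : {perm 'I_n}), a < q -> w a != d ->
  (forall p : 'I_n, q <= p -> w p = d -> w p < w a) ->
  subword_sum t (row q a) w Phi = 0%R.
Proof.
move=> Phi0; apply: (row_ind n) => [q nq|q IH] w aq wad wq.
  by rewrite row_nil //=; apply: Phi0.
rewrite row_cons /= IH ?(leq_trans aq) // => [|p qp]; last exact/wq/ltnW.
rewrite add0r /step_weight /=; case: (ltnP (w a) (w q)) => waq; last by rewrite !mul0r.
have nwq : w q != d.
  by apply/eqP => e; move: (wq q (leqnn _) e); rewrite ltnNge ltnW.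
rewrite IH ?mulr0 ?rmulL // ?(leq_trans aq) // => p qp.
rewrite !rmulD -?val_eqE /= ?neq_ltn ?qp ?(ltn_trans aq) //.
by move=> e; apply: ltn_trans waq; apply: wq e; apply: ltnW.
Qed.

(** Any swap raises the value at [a] and leaves the old value behind, so only the empty choice
    survives. *)
Lemma row_stay {R : comNzRingType} (t : R) {n : nat} (a : 'I_n) (Phi : {perm 'I_n} -> R)
    q (w : {perm 'I_n}) :
  (forall u : {perm 'I_n}, u a != w a -> Phi u = 0%R) -> a < q ->
  subword_sum t (row q a) w Phi = Phi w.
Proof.
move=> Phi0; move: q; apply: (row_ind n) => [q nq|q IH] aq; first by rewrite row_nil.
rewrite row_cons /= IH ?(leq_trans aq) // /step_weight /=.
case: (ltnP (w a) (w q)) => waq; last by rewrite !mul0r addr0.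
rewrite (row_zero _ _ (w a)) ?mulr0 ?addr0 ?(leq_trans aq) // ?rmulL.
  by apply: contraTneq waq => ->; rewrite ltnn.
move=> p qp; rewrite rmulD -?val_eqE /= ?neq_ltn ?qp ?(ltn_trans aq) //.
by move/perm_inj => e; move: qp; rewrite e ltnNge ltnW.
Qed.

Lemma between_recr {n : nat} (w : 'I_n -> 'I_n) (a q d : 'I_n) : a < q ->
  between w a q.+1 d = between w a q d + ((w a < w q) && (w q < d)).
Proof.
move=> aq; rewrite /between (bigD1 q) //= [in RHS](bigD1 q) //= aq ltnn ltnSn /= add0n addnC.
congr (_ + _); apply: eq_bigr => p pq.
by rewrite ltnS (leq_eqVlt p q) (inj_eq val_inj) (negPf pq).
Qed.

(** The values between [w a] and [d] split at [w q]; position [q] itself drops out of the second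
    count, since after the swap it holds [w a]. *)
Lemma between_swap {n : nat} (w : {perm 'I_n}) (a q d : 'I_n) : a < q -> w a < w q -> w q < d ->
  between w a q (w q) + between (rmul n w (a, q)) a q.+1 d = between w a q d.
Proof.
move=> aq waq wqd; rewrite between_recr // rmulL rmulR (leq_gtF (ltnW waq)) addn0.
rewrite /between -big_split /=; apply: eq_bigr => p _; rewrite rmulL.
case: (ltnP a p) => //= ap; case: (ltnP p q) => //= pq.
rewrite rmulD -?val_eqE /= ?neq_ltn ?ap ?pq ?orbT //.
have : (w p : nat) != w q by rewrite (inj_eq val_inj) (inj_eq perm_inj) -val_eqE neq_ltn pq.
lia.
Qed.

(* Induction on the next position [q] of the row: when [w a < w q < d], skipping [q] gives a
   factor [t] and swapping gives [1 - t], and these add up to [1]. *)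
Lemma row_move {R : comNzRingType} (t : R) {n : nat} (a d : 'I_n) (h : nat) (K : R)
    (Phi : {perm 'I_n} -> R) :
  a < h -> (forall u : {perm 'I_n}, u a != d -> Phi u = 0%R) ->
  forall q (w : {perm 'I_n}) (r : 'I_n), h <= q -> q <= r -> w r = d -> w a < d ->
  (forall u : {perm 'I_n}, u a = d -> (forall p : 'I_n, p < h -> p != a -> u p = w p) ->
     Phi u = K) ->
  subword_sum t (row q a) w Phi = ((1 - t) * t ^+ between w a q d * K)%R.
Proof.
move=> ah Phi0; apply: (row_ind n) => [q nq|q IH] w r hq qr wr wad PhiK.
  by move: (ltn_ord r); rewrite ltnNge (leq_trans nq).
have aq : a < q := leq_trans ah hq.
have aq1 : a < q.+1 := ltnW aq.
have hq1 : h <= q.+1 := leqW hq.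
have nwad : w a != d by apply: contraTneq wad => ->; rewrite ltnn.
rewrite row_cons /= /step_weight /=.
have PhiK' (u : {perm 'I_n}) : u a = d ->
    (forall p : 'I_n, p < h -> p != a -> u p = rmul n w (a, q) p) -> Phi u = K.
  move=> ua up; apply: PhiK => // p ph pa; rewrite up // rmulD 1?eq_sym //.
  by rewrite -val_eqE /= neq_ltn (leq_trans ph) ?orbT.
move: qr; rewrite leq_eqVlt => /orP[/eqP/val_inj|qr].
  (* Here [d] sits at [q]: skipping would leave it behind for good, so the swap is forced and the
     rest of the row stays idle. *)
  move=> e; rewrite -{r}e in wr.
  rewrite (row_zero _ _ _ _ Phi0) // => [|p qp]; last first.
    by rewrite -wr => /perm_inj e; move: qp; rewrite e ltnn.
  rewrite wr wad mul1r add0r row_stay ?rmulL ?wr // (PhiK' _ _ (fun=> _)) ?rmulL //.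
rewrite (IH w r) // between_recr //.
case: (ltnP (w a) (w q)) => waq; last by rewrite !mul0r !addr0 addn0.
have [wqd|dwq] := ltnP (w q) d.
  rewrite (IH _ r) ?rmulL //; last first.
    by rewrite rmulD -?val_eqE /= ?neq_ltn ?qr ?(ltn_trans aq).
  rewrite addn1 -(between_swap w a q d) // exprS mul1r exprD.
  by ring.
(* Here [w q] exceeds [d]: a swap would overshoot, so only skipping counts. *)
rewrite (row_zero _ _ _ _ Phi0) ?mulr0 ?addr0 ?addn0 ?rmulL //.
  by rewrite -wr (inj_eq perm_inj) -val_eqE /= neq_ltn qr.
move=> p qp pd; rewrite pd ltn_neqAle dwq andbT; apply/eqP => /val_inj e.
by move: qr; rewrite -wr in e; move/perm_inj: e => ->; rewrite ltnn.
Qed.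

(** * Rectangular blocks of transpositions *)

(** If [C i = D i], the interval of values is empty and the weight is 1, so one formula covers both
    cases. *)
Definition row_weight {R : comNzRingType} (t : R) {n : nat} (h : nat) (C D : 'I_n -> 'I_n)
    (i : 'I_n) : R := ((1 - t) ^+ (C i < D i)%N * t ^+ between C i h (D i))%R.

(** [Gfull k] is [rect k k], and [Gprime k] is [rect k k.+1]. *)
Definition rect {n : nat} (h' h : nat) : seq ('I_n * 'I_n) :=
  flatten [seq row h a | a : 'I_n <- enum 'I_n & a < h'].

(** When row [r] starts, the positions before [r] hold [D] and those from [r] up to [h] still hold
    [C], because row [a] swaps [a] only with positions at or after [h]; each row then multiplies the
    sum by its weight. *)
Lemma subword_sum_rect {R : comNzRingType} (t : R) {n : nat} (h' h : nat) (C D : 'I_n -> 'I_n)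
    (w : {perm 'I_n}) (Psi : {perm 'I_n} -> R) (K : R) :
  h' <= h ->
  (forall i : 'I_n, i < h' -> C i <= D i) ->
  (forall i j : 'I_n, i < h' -> j < h' -> i != j -> D i != D j) ->
  (forall i p : 'I_n, i < h' -> i < p -> p < h -> D i != C p) ->
  (forall u : {perm 'I_n}, (forall i : 'I_n, i < h' -> u i = D i) -> Psi u = K) ->
  (forall p : 'I_n, p < h -> w p = C p) ->
  subword_sum t (rect h' h) w
    (fun u => ([forall i : 'I_n, (i < h')%N ==> (D i == u i)]%:R * Psi u)%R)
  = ((\prod_(i < n | (i < h')%N) row_weight t h C D i) * K)%R.
Proof.
move=> hh CD DD DC PsiK wC.
set Phi := (fun u => _); pose A r := [seq a : 'I_n <- [seq a : 'I_n <- enum 'I_n | r <= a] | a < h'].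
have -> : rect h' h = flatten [seq row h a | a <- A 0].
  by rewrite /rect /A filter_predT.
suff: forall r (w : {perm 'I_n}),
    (forall p : 'I_n, p < r -> p < h' -> w p = D p) ->
    (forall p : 'I_n, r <= p -> p < h -> w p = C p) ->
    subword_sum t (flatten [seq row h a | a <- A r]) w Phi
    = ((\prod_(i < n | (r <= i < h')%N) row_weight t h C D i) * K)%R.
  by move=> /(_ 0 w) -> // p _; apply: wC.
apply: (row_ind n) => [r nr|r IH] {wC}w wD wC.
  rewrite /A enum_ord_ge_nil //= big_pred0 ?mul1r => [|i]; last first.
    by rewrite leqNgt (leq_trans (ltn_ord i)).
  have wD' (i : 'I_n) : i < h' -> w i = D i by apply: wD; apply: leq_trans nr.
  rewrite /Phi PsiK // (_ : [forall i, _]) ?mul1r //.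
  by apply/forallP => i; apply/implyP => /wD' ->.
rewrite /A enum_ord_ge_cons /=; case: ifP => rh'; last first.
  rewrite (IH w) //; first last.
  - by move=> p rp; apply: wC; apply: ltnW.
  - by move=> p pr ph'; apply: wD => //; lia.
  congr (_ * _)%R; apply: eq_bigl => i; lia.
have rh : r < h := leq_trans rh' hh.
have Phi0 (u : {perm 'I_n}) : u r != D r -> Phi u = 0%R.
  move=> ur; rewrite /Phi (_ : [forall i, _] = false) ?mul0r //.
  by apply/negbTE/forallPn; exists r; rewrite rh' /= eq_sym.
rewrite /= subword_sum_cat -/(A _).
set L := flatten _; set Xi := (fun u => _).
(* Later rows never touch position [r], so a wrong value there cannot be repaired. *)
have Xi0 (u : {perm 'I_n}) : u r != D r -> Xi u = 0%R.
  move=> ur; apply: (subword_sum_fix0 _ r) => [|v vr]; last by apply: Phi0; rewrite vr.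
  apply/allP => -[x y] /flattenP[s /mapP[a]]; rewrite !mem_filter => /and3P[_ ra _] ->.
  case/mapP => b; rewrite mem_filter => /andP[hb _] [-> ->] /=.
  by rewrite -!val_eqE /= !neq_ltn ra (leq_trans rh hb) !orbT.
have -> : (\prod_(i < n | (r <= i < h')%N) row_weight t h C D i * K =
   row_weight t h C D r *
    ((\prod_(i < n | (r < i < h')%N) row_weight t h C D i) * K))%R.
  rewrite (bigD1 r) /= ?leqnn // mulrA; congr (_ * _ * _)%R; apply: eq_bigl => i.
  by rewrite -val_eqE /=; lia.
have XiK (u : {perm 'I_n}) : u r = D r ->
    (forall p : 'I_n, p < h -> p != r -> u p = w p) ->
    Xi u = (\prod_(i < n | (r < i < h')%N) row_weight t h C D i * K)%R.
  move=> ur uw; apply: IH => p pr ph.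
    have [->|pnr] := eqVneq p r; first by [].
    rewrite uw ?(leq_trans ph) // wD //; by rewrite ltn_neqAle pnr -ltnS.
  rewrite uw ?wC //; first exact: ltnW.
  by rewrite -val_eqE /= neq_ltn pr orbT.
have wr : w r = C r by apply: wC.
rewrite /row_weight; have := CD r rh'; rewrite leq_eqVlt => /orP[/eqP/val_inj e|CDr].
  rewrite -e ltnn expr0 mul1r /between big1 ?expr0 ?mul1r => [|p _]; last by lia.
  by rewrite row_stay // ?XiK // ?wr // -?e // => u; rewrite e; apply: Xi0.
rewrite CDr expr1.
pose r' : 'I_n := (w^-1)%g (D r).
have wr' : w r' = D r by rewrite /r' permKV.
rewrite (row_move _ _ (D r) h _ _ rh Xi0 h w r' _ _ _ _ XiK) ?wr //.
  congr (_ * t ^+ _ * _)%R; apply: eq_bigr => p _.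
  case: (ltnP r p) => //= rp; case: (ltnP p h) => //= ph.
  by rewrite wr wC // ltnW.
(* [D r] must sit at or after [h]: before [r] it would repeat an entry of [D], at [r] it contradicts
   [C r < D r], and between [r] and [h] it would be an attack. *)
rewrite leqNgt; apply/negP => r'h.
have [r'r|rr'] := ltnP r' r.
  have r'h' := ltn_trans r'r rh'.
  move: (wD r' r'r r'h'); rewrite wr' => /eqP; apply/negP; apply: DD => //.
  by rewrite -val_eqE neq_ltn r'r orbT.
move: (wC r' rr' r'h); rewrite wr' => e.
move: rr'; rewrite leq_eqVlt => /orP[/eqP/val_inj e'|rr'].
  by move: CDr; rewrite e -e' ltnn.
by move: (DC r r' rh' rr' r'h); rewrite e eqxx.
Qed.

Lemma rect_lt {n : nat} h' h : h' <= h -> all (fun r : 'I_n * 'I_n => r.1 < r.2) (rect h' h).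
Proof.
move=> hh; apply/allP => -[x y] /flattenP[s /mapP[a]]; rewrite mem_filter => /andP[ah _] ->.
case/mapP => b; rewrite mem_filter => /andP[hb _] [-> ->] /=.
by rewrite (leq_trans ah) // (leq_trans hh).
Qed.

(** * Column heights and blocks of the shape *)

(** A predicate closed downwards holds on an initial segment, whose length is its count. *)
Lemma lt_count_iota (P : pred nat) n i :
  (forall i j, i < j -> j < n -> P j -> P i) -> i < n -> (i < count P (iota 0 n)) = P i.
Proof.
move=> Panti ltin; rewrite -(subnKC ltin) iotaD count_cat add0n.
have [Pi|nPi] := boolP (P i).
  rewrite (_ : count P (iota 0 i.+1) = i.+1); first by rewrite addSn ltnS leq_addr.
  apply/eqP; rewrite -[X in _ == X](size_iota 0) -all_count; apply/allP => k.
  rewrite mem_iota /= add0n ltnS leq_eqVlt => /orP[/eqP -> //|ki].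
  exact: Panti Pi.
have -> : iota 0 i.+1 = iota 0 i ++ [:: i] by rewrite -addn1 iotaD add0n.
rewrite count_cat /= (negPf nPi) !addn0 ltnNge.
rewrite [count P (iota i.+1 _)](_ : _ = 0) ?addn0.
  by rewrite (leq_trans (count_size _ _)) ?size_iota.
apply/eqP; rewrite eqn0Ngt -has_count; apply/hasPn => k; rewrite mem_iota => /andP[ik kn].
by apply: contraNN nPi; apply: Panti => //; rewrite subnKC in kn.
Qed.

Section Shape.
Variables (n : nat) (lam : seq nat).
Hypotheses (n_gt0 : 0 < n) (size_lam : size lam = n) (lam_sorted : sorted geq lam)
  (lam_last : nth 0 lam n.-1 = 0).

Lemma mu_decr i j : i < j -> j < n -> mu n lam j < mu n lam i.
Proof.
move=> ij jn; rewrite /mu.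
have := sorted_leq_nth (leT := geq) (fun x y z xy yz => leq_trans yz xy) leqnn 0 lam_sorted.
move=> /(_ i j); rewrite !inE size_lam jn (ltn_trans ij jn) => /(_ isT isT (ltnW ij)) /=.
lia.
Qed.

Lemma lt_conj i j : i < n -> (i < conj n lam j) = (j < mu n lam i).
Proof.
move=> ltin; apply: lt_count_iota => // k l kl ln jl.
exact: ltn_trans jl (mu_decr _ _ kl ln).
Qed.

Lemma conj_le j : conj n lam j <= n.
Proof. by rewrite (leq_trans (count_size _ _)) ?size_iota. Qed.

Lemma conj0 : conj n lam 0 = n.-1.
Proof.
apply/eqP; rewrite eqn_leq; apply/andP; split.
  have := lt_conj n.-1 0; rewrite ltn_predL n_gt0 /mu lam_last subnn => /(_ isT).
  by rewrite addn0 ltnn => /negbT; rewrite -leqNgt.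
case e: n.-1 => [//|m]; rewrite lt_conj; last by lia.
by rewrite /mu e subSn // addnS.
Qed.

Lemma conj_out j : ncols n lam <= j -> conj n lam j = 0.
Proof.
by move=> h; apply/eqP; rewrite eqn0Ngt lt_conj // -leqNgt.
Qed.

Lemma conj_decr j : conj n lam j.+1 <= conj n lam j.
Proof. by apply: sub_count => i; apply: ltn_trans. Qed.

(** Otherwise row [h] would have length at most [j.+1] and row [h.+1] at least [j.+1], whereas [rho]
    makes row lengths strictly decreasing. *)
Lemma conj_step j : conj n lam j <= (conj n lam j.+1).+1.
Proof.
rewrite leqNgt; apply/negP; set h := conj n lam j.+1 => hj.
have hn : h.+1 < n := leq_trans hj (conj_le j).
have := lt_conj h j.+1 (ltnW hn); rewrite ltnn => /esym/negbT.
have := lt_conj h.+1 j hn; rewrite hj => /esym.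
have := mu_decr h h.+1 (ltnSn h) hn.
lia.
Qed.

Lemma conj_anti i j : i <= j -> conj n lam j <= conj n lam i.
Proof. by move=> ij; apply: sub_count => k; apply: leq_trans. Qed.

Lemma in_shapeE i j : in_shape n lam i j = (i < conj n lam j).
Proof.
rewrite /in_shape; have [//|/conj_out ->] := ltnP j (ncols n lam).
by rewrite ltn0.
Qed.

(** The first column has height [n.-1] and is the first of its height, so its block is
    [Gprime n.-1], whose transpositions would need a position beyond the last one. *)
Lemma block0 : block n lam 0 = [::].
Proof.
have E : flatten [seq [seq (a, b) | b : 'I_n <- enum 'I_n & n <= b]
    | a : 'I_n <- enum 'I_n & a < n.-1] = [::].
  by rewrite enum_ord_ge_nil //; elim: [seq _ <- _ | _].
rewrite /block; case: ifP; rewrite /Gprime /Gfull conj0 ?prednK //.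
(* The search yields index 0 even on an empty list, by default, so the second branch is
   contradictory. *)
by case: (ncols n lam) => [|m] /=; rewrite ?eqxx // conj0 eqxx.
Qed.

(** If column [j.+1] is the first of its height, column [j] is taller by exactly one, and dropping
    the first transposition of each row makes the rows start at the taller height; otherwise the two
    heights agree. *)
Lemma blockS j : j.+1 < ncols n lam ->
  block n lam j.+1 = rect (conj n lam j.+1) (conj n lam j).
Proof.
move=> jn; rewrite /block; set P := fun i => _.
have nthj i : i <= j.+1 -> nth 0 (iota 0 (ncols n lam)) i = i.
  by move=> ij; rewrite nth_iota // (leq_ltn_trans ij).
case: ifPn => [/eqP e|].
  have := before_find 0 (a := P) (s := iota 0 (ncols n lam)) (i := j).
  rewrite e ltnSn nthj // => /(_ isT) /negbT; rewrite /P => ne.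
  have -> : conj n lam j = (conj n lam j.+1).+1.
    by have := conj_decr j; have := conj_step j; lia.
  by [].
rewrite neq_ltn => /orP[lt|gt]; last first.
  by move: (before_find 0 gt); rewrite nthj // /P eqxx.
have hasP : has P (iota 0 (ncols n lam)).
  by rewrite has_find (ltn_trans lt) // size_iota.
move: (nth_find 0 hasP); rewrite nthj 1?ltnW // /P => /eqP e.
suff -> : conj n lam j = conj n lam j.+1 by [].
by apply/eqP; rewrite eqn_leq conj_decr andbT -e; apply: conj_anti; rewrite -ltnS.
Qed.

Lemma chain_lt : all (fun r : 'I_n * 'I_n => r.1 < r.2) (chain n lam).
Proof.
apply/allP => r /flattenP[s /mapP[j _ ->]]; rewrite /block.
by case: ifP => _; move: r; apply/allP; [apply: (rect_lt _ _ (leqnSn _)) | apply: rect_lt].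
Qed.

Definition col_check (sigma : 'I_n -> nat -> 'I_n) (j : nat) (u : {perm 'I_n}) : bool :=
  [forall i : 'I_n, (i < conj n lam j) ==> (sigma i j == u i)].

Lemma fill_eqE (sigma : 'I_n -> nat -> 'I_n) w T :
  fill_eq n lam sigma w T =
  block_checks (block n lam) (col_check sigma) (iota 0 (ncols n lam)) w T.
Proof.
rewrite block_checksE; apply/forallP/allP => [H j|H i].
  rewrite mem_iota add0n /= => jn; rewrite add0n.
  by apply/forallP => i; apply: (forallP (H i) (Ordinal jn)).
apply/forallP => j.
have /H : (j : nat) \in iota 0 (ncols n lam) by rewrite mem_iota add0n /=.
by move=> /forallP /(_ i).
Qed.

(** * Comparison of consecutive columns of a filling *)

Section Filling.
Variable sigma : 'I_n -> nat -> 'I_n.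
Hypothesis sigmaF : in_F n lam sigma.

Lemma filling_column j (x y : 'I_n) :
  x < conj n lam j -> y < conj n lam j -> x != y -> sigma x j != sigma y j.
Proof. by rewrite -!in_shapeE; case: sigmaF => H _ _; apply: H. Qed.

Lemma filling_attack j (x y : 'I_n) :
  y < conj n lam j -> x < conj n lam j.+1 -> x < y -> sigma x j.+1 != sigma y j.
Proof.
by rewrite -!in_shapeE eq_sym; case: sigmaF => _ H _; apply: H.
Qed.

Lemma filling_row j (x : 'I_n) : x < conj n lam j.+1 -> sigma x j <= sigma x j.+1.
Proof.
move=> xj; have xj' := leq_trans xj (conj_decr j).
by case: sigmaF => _ _; apply; rewrite in_shapeE.
Qed.

Definition col_ascents k : nat :=
  \sum_(i < n | i < conj n lam k.+1) (sigma i k < sigma i k.+1).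

(** This is [N(C,D)] for [C] and [D] the columns [k] and [k.+1]. *)
Definition col_between k : nat :=
  \sum_(i < n | i < conj n lam k.+1) between (sigma^~ k) i (conj n lam k) (sigma i k.+1).

Definition col_len k : nat :=
  \sum_(x < n) \sum_(y < n) [&& x < y, y < conj n lam k & sigma y k < sigma x k].

(** The conditions of [in_F] are what [subword_sum_rect] asks of two consecutive columns; the
    remaining sum depends on the permutation only through the column just reached, hence is a
    constant [K]. *)
Lemma block_sum_eval {R : comNzRingType} (t : R) m j (w : {perm 'I_n}) :
  (j + m).+1 = ncols n lam -> (forall i : 'I_n, i < conj n lam j -> w i = sigma i j) ->
  block_sum t (block n lam) (col_check sigma) (iota j.+1 m) w =
  (\prod_(j <= k < j + m) ((1 - t) ^+ col_ascents k * t ^+ col_between k))%R.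
Proof.
elim: m j w => [|m IH] j w jm wj /=; first by rewrite addn0 big_geq.
rewrite blockS; last by lia.
rewrite big_ltn; last by lia.
rewrite (subword_sum_rect t _ _ (sigma^~ j) (sigma^~ j.+1) w _
   (\prod_(j.+1 <= k < j + m.+1) ((1 - t) ^+ col_ascents k * t ^+ col_between k))%R) //.
- congr (_ * _)%R; rewrite /col_ascents /col_between !expr_sum -big_split /=.
  by apply: eq_bigr.
- exact: conj_decr.
- by move=> i; apply: filling_row.
- by move=> x y; apply: filling_column.
- by move=> x y xj xy yj; apply: filling_attack.
by move=> u uj; rewrite IH ?addSnnS // -addSnnS.
Qed.

Lemma des_fill_sum : des_fill n lam sigma = \sum_(k < ncols n lam) col_ascents k.
Proof.
apply: eq_bigr => k _; rewrite cardsE -sum1_card /col_ascents big_mkcond [RHS]big_mkcond /=.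
apply: eq_bigr => i _; rewrite unfold_in !in_shapeE.
by have := conj_decr k; case: ltnP => ?; case: ltnP => ?; case: ltnP => ? //=; lia.
Qed.

(** The pair is reversed with respect to [inv_fill]: the upper row comes first, as in [col_len]. *)
Definition col_inv k : nat :=
  \sum_(x < n) \sum_(y < n) [&& x < y, y < conj n lam k, x < conj n lam k.+1,
    sigma y k < sigma x k.+1 & (y < conj n lam k.+1) ==> (sigma x k.+1 < sigma y k.+1)].

Lemma inv_fill_sum : inv_fill n lam sigma = \sum_(k < ncols n lam) col_inv k.
Proof.
apply: eq_bigr => k _; rewrite cardsE -sum1_card /col_inv exchange_big pair_big big_mkcond /=.
apply: eq_bigr => -[y x] _; rewrite unfold_in /= !in_shapeE.
set b := [&& _, _, _, _ & _]; set c := [&& _, _, _, _ & _].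
suff -> : b = c by case: c.
by rewrite /b /c; do 3!case: ltnP => ? //=.
Qed.

Lemma lenC_sum : lenC n lam sigma = col_len 0.
Proof.
rewrite /lenC cardsE -sum1_card /col_len pair_big big_mkcond /=.
apply: eq_bigr => -[x y] _; rewrite unfold_in /= in_shapeE.
by case: [&& _, _ & _].
Qed.

(* [(xC, xD)] and [(yC, yD)] are the entries of rows [i < j] in consecutive columns of heights
   [h] and [h']; this is [ell(C) + N(C,D) = inv(C,D) + ell(D)] for a single pair of rows. *)
Lemma telescope_indicators (i j h h' xC yC xD yD : nat) : i < j -> h' <= h -> h <= h'.+1 ->
  (i < h -> j < h -> true -> xC != yC) -> (i < h' -> j < h' -> true -> xD != yD) ->
  (j < h -> i < h' -> true -> xD != yC) -> (i < h' -> xC <= xD) -> (j < h' -> yC <= yD) ->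
  ((j < h) && (yC < xC)) + [&& i < h', j < h, xC < yC & yC < xD] =
  [&& j < h, i < h', yC < xD & (j < h') ==> (xD < yD)] + ((j < h') && (yD < xD)).
Proof.
move=> ij hh' h'h.
have [jh|hj] := ltnP j h => /=; last first.
  by rewrite (_ : (j < h') = false) ?andbF //; lia.
have ih : i < h := ltn_trans ij jh.
(* The heights differ by at most one, so a row lying above another row of [C] is also a row of
   [D]. *)
have ih' : i < h' by lia.
rewrite ih ih' => /(_ isT isT isT) c /(_ isT) d /(_ isT isT isT) a /(_ isT) x.
case: (ltnP j h') d => jh' /= d y; last by rewrite addn0; lia.
have {}d := d isT isT; have {}y := y isT.
lia.
Qed.

Lemma col_len_between k : col_len k + col_between k = col_inv k + col_len k.+1.
Proof.
have -> : col_between k = \sum_(x < n) \sum_(y < n) [&& x < conj n lam k.+1, x < y,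
    y < conj n lam k, sigma x k < sigma y k & sigma y k < sigma x k.+1].
  rewrite /col_between big_mkcond; apply: eq_bigr => x _.
  by case: ltnP => // _; rewrite big1.
rewrite /col_len /col_inv -!big_split; apply: eq_bigr => x _.
rewrite -!big_split; apply: eq_bigr => y _ /=.
case: (ltnP x y) => xy //=; rewrite ?andbF //.
have := conj_decr k; have := conj_step k.
have := filling_column k x y; have := filling_column k.+1 x y.
have := filling_attack k x y; have := filling_row k x; have := filling_row k y.
have xy' : x != y by rewrite -val_eqE neq_ltn xy.
(* The premises [x < y] and [x != y] become [true], the shape in which [telescope_indicators] takes
   its hypotheses. *)
rewrite xy xy' -!(inj_eq val_inj) /=.
move: (nat_of_ord (sigma x k)) (nat_of_ord (sigma y k)) (nat_of_ord (sigma x k.+1))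
  (nat_of_ord (sigma y k.+1)) => xC yC xD yD yCD xCD att colD colC hh' h'h.
exact: telescope_indicators.
Qed.

Lemma col_len_out : col_len (ncols n lam) = 0.
Proof.
rewrite /col_len big1 // => x _; rewrite big1 // => y _.
by rewrite conj_out // ltn0 andbF.
Qed.

(** [col_len_between] telescopes over the columns, ending with an empty column beyond the shape. *)
Lemma lenC_between : lenC n lam sigma + \sum_(k < ncols n lam) col_between k = inv_fill n lam sigma.
Proof.
rewrite lenC_sum inv_fill_sum.
have H m : col_len 0 + \sum_(k < m) col_between k = \sum_(k < m) col_inv k + col_len m.
  elim: m => [|m IH]; first by rewrite !big_ord0 addnC.
  by rewrite !big_ord_recr /= addnA IH -!addnA col_len_between.
by rewrite H col_len_out addn0.
Qed.

End Filling.
End Shape.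

(** * The permutation forced by the first column *)

Lemma sum_ord_gt n a : \sum_(i < n) (a < i) = n - a.+1.
Proof. by elim: n => [|n IH]; rewrite ?big_ord0 // big_ord_recr /= IH; lia. Qed.

Section FirstColumn.
Variables (n : nat) (lam : seq nat) (sigma : 'I_n -> nat -> 'I_n) (a0 : 'I_n).
Hypotheses (size_lam : size lam = n) (lam_sorted : sorted geq lam)
  (lam_last : nth 0 lam n.-1 = 0) (sigmaF : in_F n lam sigma)
  (a0_missing : forall i : 'I_n, in_shape n lam i 0 -> sigma i 0 != a0).

Let n_gt0 : 0 < n := leq_ltn_trans (leq0n a0) (ltn_ord a0).

Definition start_fun (i : 'I_n) : 'I_n := if i < n.-1 then sigma i 0 else a0.

Lemma start_fun_inj : injective start_fun.
Proof.
have lt0 (i : 'I_n) : i < n.-1 -> i < conj n lam 0 by rewrite conj0.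
move=> x y; rewrite /start_fun; case: ltnP => hx; case: ltnP => hy e.
- apply/eqP; apply: contraT => xy.
  have := sigmaF => -[H _ _]; move: (H 0 x y); rewrite !in_shapeE // e eqxx.
  by move=> /(_ (lt0 _ hx) (lt0 _ hy) xy).
- by move: (a0_missing x); rewrite in_shapeE // e eqxx => /(_ (lt0 _ hx)).
- by move: (a0_missing y); rewrite in_shapeE // e eqxx => /(_ (lt0 _ hy)).
by apply: val_inj => /=; have := ltn_ord x; have := ltn_ord y; lia.
Qed.

Definition start : {perm 'I_n} := perm start_fun_inj.

Lemma startE (i : 'I_n) : i < conj n lam 0 -> start i = sigma i 0.
Proof. by rewrite conj0 // permE /start_fun => ->. Qed.

(** The first column fixes [n.-1] values of [u], and the last value of a permutation is then
    forced. *)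
Lemma col_check_start u : col_check n lam sigma 0 u = (u == start).
Proof.
apply/forallP/eqP => [H|-> i]; last by apply/implyP => /startE ->.
have ustart (i : 'I_n) : i < n.-1 -> u i = start i.
  by move=> ilt; rewrite startE ?conj0 //; move: (H i); rewrite conj0 // ilt => /eqP.
apply/permP => i; have [/ustart //|ni] := ltnP i n.-1.
pose k := (start^-1)%g (u i).
have sk : start k = u i by rewrite permKV.
clearbody k.
have [/ustart|nk] := ltnP k n.-1; first by rewrite sk => /perm_inj ki; rewrite -sk ki.
rewrite -sk; congr (start _); apply: val_inj => /=.
by have := ltn_ord i; have := ltn_ord k; lia.
Qed.

(** Inversions ending at the last position count the values above [a0]; there are [n - a0.+1] of
    them, which is [n - a_0] as [a0] is 0-based. The others are the inversions of [C]. *)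
Lemma len_start : len n start = n - a0.+1 + lenC n lam sigma.
Proof.
have lastP : n.-1 < n by rewrite prednK.
pose l := Ordinal lastP.
have startl : start l = a0 by rewrite permE /start_fun ltnn.
rewrite lenC_sum // len_sum addnC -(sum_ord_gt n a0).
have -> : \sum_(i < n) (a0 < i) = \sum_(x < n) (a0 < start x).
  by rewrite (reindex_inj (@perm_inj _ start)).
rewrite /col_len -big_split; apply: eq_bigr => x _ /=.
rewrite (bigD1 l) //= [in RHS](bigD1 l) //= conj0 // ltnn andbF add0n addnC startl.
congr (_ + _).
  apply: eq_bigr => y yl; have yn : y < n.-1.
    by move: yl; rewrite -val_eqE /=; have := ltn_ord y; lia.
  rewrite yn; case: ltnP => //= xy.
  by rewrite !startE ?conj0 // (ltn_trans xy).
case: ltnP => //= xl; have -> : x = l.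
  by apply: val_inj => /=; have := ltn_ord x; lia.
by rewrite startl ltnn.
Qed.

(** Since the first block is empty, the first check is made on [w] itself. *)
Lemma block_sum_start {R : comNzRingType} (t : R) (w : {perm 'I_n}) :
  block_sum t (block n lam) (col_check n lam sigma) (iota 0 (ncols n lam)) w =
  ((w == start)%:R *
    ((1 - t) ^+ des_fill n lam sigma
      * t ^+ (\sum_(k < ncols n lam) col_between n lam sigma k)%N))%R.
Proof.
rewrite -col_check_start des_fill_sum //.
(* Without columns the check is vacuous and both exponents are empty sums. *)
have [ncols0|] := posnP (ncols n lam).
  rewrite ncols0 /= !big_ord0 /= !mulr1 (_ : col_check _ _ _ _ _ = true) //.
  by apply/forallP => i; rewrite conj_out // ncols0.
move=> /prednK; set m := (ncols n lam).-1 => mE.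
rewrite -mE /= block0 //=; have [wC|_] := boolP (col_check _ _ _ _ _); last by rewrite !mul0r.
rewrite !mul1r (block_sum_eval _ _ _ _ _ _ _ sigmaF _ m 0) //; last first.
  by move=> i i0; apply/esym/eqP; apply: (implyP (forallP wC i)).
(* There are only [m] transitions between [m.+1] columns; the extra index [m] in both sums
   contributes 0, as the last column has no right neighbour. *)
have conj_m : conj n lam m.+1 = 0 by rewrite conj_out // -mE.
rewrite big_split /= add0n -!expr_sum !big_ord_recr /= !big_mkord.
have -> : col_ascents n lam sigma m = 0 by rewrite /col_ascents conj_m big_pred0.
have -> : col_between n lam sigma m = 0 by rewrite /col_between conj_m big_pred0.
by rewrite !addn0.
Qed.
End FirstColumn.

(** * Evaluation of the signed sum over the fibre *)

Theorem theorem3p1 (n : nat) (lam : seq nat) (sigma : 'I_n -> nat -> 'I_n)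
    (a0 : 'I_n) :
  size lam = n -> sorted geq lam -> nth 0 lam n.-1 = 0 ->
  in_F n lam sigma ->
  (forall i : 'I_n, in_shape n lam i 0 -> sigma i 0 != a0) ->
  (\sum_(w : {perm 'I_n})
     \sum_(T : (size (chain n lam)).-tuple bool |
             admissible n lam w T && fill_eq n lam sigma w T)
       ((-1) ^+ len n (wT n lam w T)
        * 'X ^+ ((len n w + len n (wT n lam w T) - count id T)./2)%N
        * ('X - 1) ^+ count id T) : {poly int})%R
  = ((-1) ^+ (n - a0.+1 + lenC n lam sigma)%N
     * 'X ^+ (n - a0.+1 + inv_fill n lam sigma)%N
     * (1 - 'X) ^+ des_fill n lam sigma)%R.
Proof.
move=> size_lam lam_sorted lam_last sigmaF a0_missing.
have n_gt0 : 0 < n := leq_ltn_trans (leq0n a0) (ltn_ord a0).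
pose w0 := start n lam sigma a0 size_lam lam_sorted lam_last sigmaF a0_missing.
transitivity (\sum_(w : {perm 'I_n}) (- 'X) ^+ len n w * ((w == w0)%:R *
    ((1 - 'X) ^+ des_fill n lam sigma
      * 'X ^+ (\sum_(k < ncols n lam) col_between n lam sigma k)%N)) : {poly int})%R.
  apply: eq_bigr => w _.
  (* Read backwards, the block sum is a sum over all [T]: the checks encode the filling condition,
     and the path weight vanishes off the admissible [T]. *)
  rewrite -block_sum_start -bitsum_blocks -/(chain n lam) /bitsum big_distrr big_mkcond /=.
  apply: eq_bigr => T _; have sT : size T = size (chain n lam) by rewrite size_tuple.
  rewrite -fill_eqE mulrA -summand_path_weight; last first.
    by apply/allP => r /mem_mask; apply/allP: r; apply: chain_lt.
  rewrite size_mask // -/(wT n lam w T) -/(admissible n lam w T).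
  by case: (admissible _ _ _ _); case: (fill_eq _ _ _ _ _); rewrite ?mul1r ?mul0r ?mulr1 ?mulr0.
rewrite (bigD1 w0) //= [X in (_ + X)%R]big1 => [|w /negPf ->]; last by rewrite mul0r mulr0.
rewrite addr0 eqxx mul1r (exprNn 'X%R) /w0 len_start -lenC_between //.
rewrite [in RHS]addnA [in RHS](exprD 'X%R).
by rewrite [X in (_ * X = _)%R]mulrC !mulrA.
Qed.
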